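(* Let $\beta\in\mathbb{N}^m$ and $A=[A_1|\cdots|A_n]\in\mathbb{N}^{m\times n}$ be such that $\beta\geq A_k$ for each $1\leq k\leq n$. There exist nonnegative integer vectors $A^{(z)}\in\mathbb{N}^p$, one for each $z\in\mathbb{N}^m$ with $z\leq\beta$ and $z\neq0$ (depending on $A$ and $\beta$ but not on $b$), with $$A^{(e_j)}[k,u]=A_{j;k}\quad\text{for all } 1\leq j\leq m \text{ with } e_j\leq\beta,\ 1\leq k\leq n,\ u\in\mathbb{N}^m,\ u\leq\beta-A_k,$$ such that for every $b\in\mathbb{N}^m$ with $b\leq\beta$ the following hold, where (S) denotes the system of linear equations in $\mathbf{y}\in\mathbb{R}^p$ $$\text{(S)}\qquad b^z=\mathbf{y}'A^{(z)}\qquad\forall\,z\in\mathbb{N}^m,\ z\leq\beta,\ z\neq0.$$ (a) The system $Ax=b$ has a solution $x\in\mathbb{N}^n$ if and only if (S) has a nonnegative real solution $\mathbf{y}=(y[k,u])\in\mathbb{R}^p$. (b) Let $H$ be the integer hull of $\{x\in\mathbb{R}^n: Ax=b,\ x\geq0\}$. If $\mathbf{y}\in\mathbb{R}^p$ is a nonnegative real solution of (S) and $\widehat{x}=E\mathbf{y}$, i.e. $\widehat{x}_k:=\sum_{u}y[k,u]$ for $1\leq k\leq n$, then $\widehat{x}\in H$. Therefore, if some subsystem of (S) has no solution $\mathbf{y}\in\mathbb{R}^p$, then $b\neq Ax$ for every $x\in\mathbb{N}^n$. Moreover, a nonnegative vector $\mathbf{y}\in\mathbb{R}^p$ is a solution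 of (S) if and only if $\mathbf{y}\in\mathcal{P}$, where $\mathcal{P}=\{\mathbf{y}\in\mathbb{R}^p:\mathbf{y}\geq0,\ \Theta\mathbf{y}=\mathbf{b}\}$; and there is a one-to-one correspondence between the vertices of $H$ and the vertices of $\mathcal{P}$.
   Context: $\mathbb{N}=\{0,1,2,\dots\}$; prime denotes transpose; inequalities between vectors are entrywise; $A_k$ is the $k$-th column of $A$ and $A_{j;k}$ its $j$-th entry; $e_j\in\mathbb{N}^m$ is the $j$-th standard basis vector. For $w,z\in\mathbb{N}^m$, $w^z:=w_1^{z_1}\cdots w_m^{z_m}$ with $0^0=1$. Set $s:=\prod_{j=1}^m(1+\beta_j)$ and $p:=\sum_{k=1}^n\prod_{j=1}^m(1+\beta_j-A_{j;k})$. Vectors in $\mathbb{R}^s$ are indexed by $w\in\mathbb{N}^m$ with $w\leq\beta$. Vectors in $\mathbb{R}^p$ are indexed by pairs $(k,u)$ with $1\leq k\leq n$, $u\in\mathbb{N}^m$, $u\leq\beta-A_k$; $E\in\mathbb{N}^{n\times p}$ is the matrix with $(E\mathbf{y})_k=\sum_{u\leq\beta-A_k}y[k,u]$. The matrix $\Theta\in\mathbb{Z}^{s\times p}$ has as its column $(k,u)$ the vector with entry $-1$ in row $w=u$, entry $1$ in row $w=u+A_k$, and $0$ elsewhere (i.e. $\Theta[w;(k,u)]=\mathbf{1}_{\{w=u+A_k\}}-\mathbf{1}_{\{w=u\}}$). The vector $\mathbf{b}\in\mathbb{Z}^s$ has entry $-1$ at $w=0$, entry $1$ at $w=b$, and $0$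 elsewhere (i.e. $\mathbf{b}[w]=\mathbf{1}_{\{w=b\}}-\mathbf{1}_{\{w=0\}}$). The integer hull of a polyhedron in $\mathbb{R}^n$ is the convex hull of its integer points.
   Formalization: The one-to-one correspondence of vertices is proved as an injection φ from vertices of H into vertices of P with Eφ(x)=x, not as a bijection: for A=[1|2], β=b=3, H has 2 vertices and P has 3, so a bijection is impossible. *)

(* Defs.v *)
(* World: MathComp / MathComp-Analysis. *)
From mathcomp Require Import all_boot all_order all_algebra.
From mathcomp Require Import boolp classical_sets functions reals convex.

Set Implicit Arguments.
Unset Strict Implicit.
Unset Printing Implicit Defensive.

Import Order.TTheory GRing.Theory Num.Theory.
Local Open Scope classical_set_scope.
Local Open Scope ring_scope.

Definition vle (m : nat) (v w : 'cV[nat]_m) : Prop :=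
  forall j : 'I_m, (v j 0%R <= w j 0%R)%N.

(* The convention 0^0 = 1 is that of [expn]. *)
Definition mono (m : nat) (w z : 'cV[nat]_m) : nat :=
  (\prod_(j < m) w j 0%R ^ z j 0%R)%N.

(* The finite set of the integer vectors u with 0 <= u <= v. *)
Definition box (m : nat) (v : 'cV[nat]_m) : finType :=
  {dffun forall j : 'I_m, 'I_(v j 0%R).+1}.

Definition boxv (m : nat) (v : 'cV[nat]_m) (u : box v) : 'cV[nat]_m :=
  \col_j (u j : nat).

(* beta - A_k; the subtraction is truncated, hence exact only if A_k <= beta. *)
Definition slack (m n : nat) (A : 'M[nat]_(m, n)) (beta : 'cV[nat]_m)
    (k : 'I_n) : 'cV[nat]_m :=
  \col_j (beta j 0%R - A j k)%N.

(* The pairs (k, u) with u <= beta - A_k; R^s and R^p are represented by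
   functions on [box beta] and on [pidx A beta]. *)
Definition pidx (m n : nat) (A : 'M[nat]_(m, n)) (beta : 'cV[nat]_m) : finType :=
  {k : 'I_n & box (slack A beta k)}.

Definition pair_idx (m n : nat) (A : 'M[nat]_(m, n)) (beta : 'cV[nat]_m)
    (k : 'I_n) (u : box (slack A beta k)) : pidx A beta :=
  Tagged (fun k => box (slack A beta k)) u.

Definition Emul (R : realType) (m n : nat) (A : 'M[nat]_(m, n))
    (beta : 'cV[nat]_m) (y : {ffun pidx A beta -> R^o}) : 'cV[R]_n :=
  \col_k \sum_(u : box (slack A beta k)) y (pair_idx u).

Definition Theta (m n : nat) (A : 'M[nat]_(m, n)) (beta : 'cV[nat]_m)
    (w : box beta) (c : pidx A beta) : int :=
  (boxv w == boxv (tagged c) + col (tag c) A)%:R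
  - (boxv w == boxv (tagged c))%:R.

Definition bvec (m : nat) (beta b : 'cV[nat]_m) (w : box beta) : int :=
  (boxv w == b)%:R - (boxv w == 0)%:R.

Definition nonneg (R : realType) (I : finType) (y : {ffun I -> R^o}) : Prop :=
  forall c, 0 <= y c.

Definition equation (R : realType) (I : finType) (m : nat) (b : 'cV[nat]_m)
    (Az : 'cV[nat]_m -> {ffun I -> nat}) (z : 'cV[nat]_m)
    (y : {ffun I -> R^o}) : Prop :=
  (mono b z)%:R = \sum_c y c * (Az z c)%:R.

Definition exponents (m : nat) (beta : 'cV[nat]_m) : set 'cV[nat]_m :=
  [set z | vle z beta /\ z <> 0].

Definition solves (R : realType) (I : finType) (m : nat) (b : 'cV[nat]_m)
    (Az : 'cV[nat]_m -> {ffun I -> nat}) (Z : set 'cV[nat]_m)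
    (y : {ffun I -> R^o}) : Prop :=
  forall z, Z z -> equation b Az z y.

Definition flow_polyhedron (R : realType) (m n : nat) (A : 'M[nat]_(m, n))
    (beta b : 'cV[nat]_m) : set {ffun pidx A beta -> R^o} :=
  [set y | nonneg y /\
     forall w : box beta,
       \sum_c (Theta w c)%:~R * y c = (bvec b w)%:~R :> R].

Definition polyhedron (R : realType) (m n : nat) (A : 'M[nat]_(m, n))
    (b : 'cV[nat]_m) : set 'cV[R]_n :=
  [set x | map_mx (fun a : nat => a%:R) A *m x = map_mx (fun a : nat => a%:R) b
           /\ forall k, 0 <= x k 0].

Definition convex_hull (R : realType) (V : lmodType R) (S : set V) : set V :=
  smallest (@convex_set R V) S.

Definition integer_hull (R : realType) (n : nat) (S : set 'cV[R]_n) :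
    set 'cV[R]_n :=
  convex_hull (S `&` [set x | forall k, x k 0 \is a Num.int]).

(* The vertices of a polyhedron are its extreme points. *)
Definition vertices (R : realType) (V : lmodType R) (S : set V) : set V :=
  [set x | S x /\ forall (y z : V) (t : R), S y -> S z -> 0 < t < 1 ->
     x = t *: y + (1 - t) *: z -> y = z].

Arguments polyhedron R {m n} A b _.
Arguments flow_polyhedron R {m n} A beta b _.

(* Main.v *)
(* Read [y] as a flow on the acyclic graph (up to loops, when [A_k = 0]) with
   node set [0, beta] and an arc [u -> u + A_k] for each pair [(k, u)], so that
   [Theta y = b] says that [y] carries one unit from [0] to [b].  With
   [A^(z)[k, u] = (u + A_k)^z - u^z], (S) is [Theta y = b] multiplied by the
   tensor product of Vandermonde matrices [(w^z)], which is invertible.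
   A solution [x] of [A x = b] gives a path from [0] to [b]; conversely a unit
   flow is a convex combination of paths plus loops, so that [E y] is in the
   integer hull.  A path without loops is a vertex of the flow polyhedron, since
   conservation determines a flow supported on it, and [E] recovers [x]. *)
Require Import Defs.
From mathcomp Require Import all_boot all_order all_algebra.
From mathcomp Require Import boolp classical_sets functions reals convex.
From mathcomp Require Import interval_inference.

Set Implicit Arguments.
Unset Strict Implicit.
Unset Printing Implicit Defensive.

Import Order.TTheory GRing.Theory Num.Theory.
Local Open Scope classical_set_scope.
Local Open Scope ring_scope.

Lemma addv_nat (m : nat) (v w : 'cV[nat]_m) i j :
  (v + w) i j = (v i j + w i j)%N.
Proof. exact: mxE. Qed.

Section Box.
Context {m : nat}.
Implicit Types v w : 'cV[nat]_m.

Lemma vle_trans v1 v2 v3 : vle v1 v2 -> vle v2 v3 -> vle v1 v3.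
Proof. by move=> h1 h2 j; apply: leq_trans (h2 j). Qed.

Lemma vle_addr v w : vle v (v + w).
Proof. by move=> j; rewrite !mxE leq_addr. Qed.

Lemma boxv_le v (u : box v) : vle (boxv u) v.
Proof. by move=> j; rewrite mxE -ltnS. Qed.

Lemma boxv_inj v : injective (@boxv m v).
Proof.
move=> u1 u2 /matrixP e; apply/ffunP => j; apply/val_inj.
by have := e j 0; rewrite !mxE.
Qed.

Definition node v w : box v := [ffun j => inord (w j 0)].

Lemma nodeK v w : vle w v -> boxv (node v w) = w.
Proof.
by move=> h; apply/matrixP => j k; rewrite ord1 mxE ffunE inordK ?ltnS.
Qed.

Lemma boxv_eq v (u : box v) w : vle w v -> (boxv u == w) = (u == node v w).
Proof. by move=> h; rewrite -{1}(nodeK h) (inj_eq (@boxv_inj v)). Qed.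

Definition deg v : nat := (\sum_(j < m) v j 0%R)%N.

Lemma degD v w : deg (v + w) = (deg v + deg w)%N.
Proof. by rewrite /deg -big_split; apply: eq_bigr => j _; rewrite mxE. Qed.

Lemma deg_le v w : vle v w -> (deg v <= deg w)%N.
Proof. by move=> h; apply: leq_sum => j _; apply: h. Qed.

Lemma deg_eq0 v : (deg v == 0) = (v == 0).
Proof.
apply/idP/eqP => [|->]; last by rewrite /deg big1 // => j _; rewrite mxE.
rewrite sum_nat_eq0 => /forallP h; apply/matrixP => j k.
by rewrite ord1 mxE; apply/eqP; exact: (h j).
Qed.

Lemma mono0r w : mono w 0 = 1.
Proof. by rewrite /mono big1 // => j _; rewrite mxE expn0. Qed.

Lemma mono0l v : v != 0 -> mono 0 v = 0.
Proof.
move=> v0; have [j hj] : exists j, v j 0 != 0.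
  apply/existsP; apply: contraNT v0; rewrite negb_exists => /forallP h.
  apply/eqP/matrixP => j k; rewrite ord1 mxE.
  by apply/eqP; move: (h j); rewrite negbK.
by rewrite /mono (bigD1 j) //= mxE exp0n ?mul0n // lt0n.
Qed.

Lemma mono_le v w z : vle v w -> (mono v z <= mono w z)%N.
Proof.
move=> h; rewrite /mono; apply: leq_prod => j _.
by have [->|] := posnP (z j 0) => [|z0]; rewrite ?expn0 ?leq_exp2r.
Qed.

Lemma mono_delta w j : mono w (delta_mx j 0) = w j 0.
Proof.
rewrite /mono (bigD1 j) //= big1 => [|i ij].
  by rewrite mxE !eqxx muln1 expn1.
by rewrite mxE (negbTE ij) expn0.
Qed.

End Box.

(* Tensor products of Vandermonde matrices are invertible: the row of the
   inverse at [w0] consists of the coefficients of a product of univariate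
   polynomials vanishing at all the nodes but [w0]. *)
Lemma mono_sum_eq0 (R : realType) (m : nat) (v : 'cV[nat]_m)
    (f : box v -> R) :
  (forall z, vle z v -> \sum_w f w * (mono (boxv w) z)%:R = 0) ->
  forall w, f w = 0.
Proof.
move=> f0 w0.
pose q (j : 'I_m) : {poly R} :=
  \prod_(i < (v j 0).+1 | i != w0 j) ('X - (i : nat)%:R%:P).
have szq j : (size (q j) <= (v j 0%R).+1)%N.
  rewrite /q -big_filter size_prod_XsubC ltnS size_filter -sum1_count.
  by rewrite (sum1_card (predC1 (w0 j))) cardC1 card_ord.
have q0 j (i : 'I_(v j 0).+1) : i != w0 j -> (q j).[(i : nat)%:R] = 0.
  by move=> ne; rewrite /q horner_prod (bigD1 i) //= hornerXsubC subrr mul0r.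
have qN0 j : (q j).[(w0 j : nat)%:R] != 0.
  rewrite /q horner_prod prodf_seq_neq0; apply/allP => i _; apply/implyP => ne.
  by rewrite hornerXsubC subr_eq0 eqr_nat eq_sym; exact: ne.
pose N := (\max_(j < m) v j 0%R)%N.
have leN j : (v j 0%R <= N)%N by apply: (leq_bigmax j).
have qE j (x : R) : (q j).[x] = \sum_(i < N.+1) (q j)`_i * x ^+ i.
  by apply: horner_coef_wide; apply: leq_trans (szq j) _; rewrite ltnS.
have expand (w : box v) : \prod_(j < m) (q j).[(w j : nat)%:R] =
    \sum_(z : {ffun 'I_m -> 'I_N.+1}) (\prod_j (q j)`_(z j)) *
      (mono (boxv w) (\col_j (z j : nat)))%:R.
  under eq_bigr do rewrite qE.
  rewrite bigA_distr_bigA; apply: eq_bigr => z _; rewrite big_split /=.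
  congr (_ * _); rewrite /mono natr_prod; apply: eq_bigr => j _.
  by rewrite !mxE natrX.
have : \sum_w f w * \prod_(j < m) (q j).[(w j : nat)%:R] = 0.
  under eq_bigr do rewrite expand mulr_sumr.
  rewrite exchange_big big1 //= => z _.
  under eq_bigr do rewrite mulrCA.
  rewrite -mulr_sumr.
  have [/forallP h|] := boolP [forall j, (z j <= v j 0%R)%N].
    by rewrite f0 ?mulr0 // => j; rewrite mxE.
  rewrite negb_forall => /existsP[j]; rewrite -ltnNge => zj.
  by rewrite (bigD1 j) //= nth_default ?mul0r // (leq_trans (szq j)).
rewrite (bigD1 w0) //= [X in _ + X]big1 => [|w ne].
  rewrite addr0 => /eqP; rewrite mulf_eq0 => /orP[/eqP //|].
  by move/prodf_eq0 => [j _]; rewrite (negbTE (qN0 j)).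
have [j hj] : exists j, w j != w0 j.
  apply/existsP; apply: contraNT ne; rewrite negb_exists => /forallP h.
  by apply/eqP/ffunP => j; apply/eqP; move: (h j); rewrite negbK.
by rewrite (bigD1 j) //= q0 // mul0r mulr0.
Qed.

Lemma sum_indicator (R : pzRingType) (I : finType) (i : I) (f : I -> R) :
  \sum_j f j * (j == i)%:R = f i.
Proof.
rewrite (bigD1 i) //= eqxx mulr1 big1 ?addr0 // => j /negbTE ->.
by rewrite mulr0.
Qed.

Section Network.
Context {R : realType} {m n : nat} {A : 'M[nat]_(m, n)} {beta : 'cV[nat]_m}.
Hypothesis hA : forall k : 'I_n, vle (col k A) beta.
Implicit Types (c : pidx A beta) (w : box beta) (b : 'cV[nat]_m)
  (y : {ffun pidx A beta -> R^o}).

Definition src c : box beta := node beta (boxv (tagged c)).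
Definition tgt c : box beta := node beta (boxv (tagged c) + col (tag c) A).
Definition step (k : 'I_n) b : pidx A beta :=
  pair_idx (node (slack A beta k) b).

Lemma slackE k j : slack A beta k j 0 = (beta j 0%R - A j k)%N.
Proof. exact: mxE. Qed.

Lemma tgt_le c : vle (boxv (tagged c) + col (tag c) A) beta.
Proof.
move=> j; have := boxv_le (tagged c) j; have := hA (tag c) j.
by rewrite addv_nat slackE [col _ _ _ _]mxE => h; rewrite addnC -leq_subRL.
Qed.

Lemma boxv_src c : boxv (src c) = boxv (tagged c).
Proof. exact/nodeK/(vle_trans (vle_addr _ _) (tgt_le c)). Qed.

Lemma boxv_tgt c : boxv (tgt c) = boxv (src c) + col (tag c) A.
Proof. by rewrite boxv_src; apply/nodeK/tgt_le. Qed.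

Lemma src_eq_tgt c : (src c == tgt c) = (col (tag c) A == 0).
Proof.
rewrite -(inj_eq (@boxv_inj _ _)) boxv_tgt -deg_eq0.
apply/eqP/idP => [/(congr1 deg)/eqP|].
  by rewrite degD -{1}[deg _]addn0 eqn_add2l eq_sym.
by rewrite deg_eq0 => /eqP ->; rewrite addr0.
Qed.

Lemma deg_tgt c : src c != tgt c -> (deg (boxv (src c)) < deg (boxv (tgt c)))%N.
Proof.
rewrite src_eq_tgt boxv_tgt degD -deg_eq0 -lt0n => h.
by rewrite -[X in (X < _)%N]addn0 ltn_add2l.
Qed.

Lemma src_step k b : vle (b + col k A) beta -> src (step k b) = node beta b.
Proof.
move=> h; congr node; apply: nodeK => j.
have := h j; rewrite addv_nat slackE [col _ _ _ _]mxE => hj.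
by rewrite leq_subRL ?(leq_trans (leq_addl _ _) hj) // addnC.
Qed.

Lemma tgt_step k b :
  vle (b + col k A) beta -> tgt (step k b) = node beta (b + col k A).
Proof.
move=> h; congr (node _ (_ + _)).
by rewrite -boxv_src src_step // nodeK //; apply: vle_trans h; apply: vle_addr.
Qed.

Lemma ThetaE w c :
  (Theta w c)%:~R = (w == tgt c)%:R - (w == src c)%:R :> R.
Proof.
rewrite /Theta intrB !mulrz_nat; congr (_%:R - _%:R); congr nat_of_bool.
  by apply: boxv_eq; apply: tgt_le.
by apply: boxv_eq; apply: vle_trans (tgt_le c); apply: vle_addr.
Qed.

Lemma bvecE b w : vle b beta ->
  (bvec b w)%:~R = (w == node beta b)%:R - (w == node beta 0)%:R :> R.
Proof.
move=> hb; rewrite /bvec intrB !mulrz_nat boxv_eq // boxv_eq // => j.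
by rewrite mxE.
Qed.

Definition net_flow y w : R :=
  \sum_c y c * ((w == tgt c)%:R - (w == src c)%:R).

Lemma flow_polyhedronE b y : vle b beta ->
  flow_polyhedron R A beta b y <->
  nonneg y /\
  forall w, net_flow y w = (w == node beta b)%:R - (w == node beta 0)%:R.
Proof.
move=> hb.
have E w : \sum_c (Theta w c)%:~R * y c = net_flow y w.
  by apply: eq_bigr => c _; rewrite ThetaE mulrC.
by split=> -[y0 h]; split=> // w; move: (h w); rewrite E bvecE.
Qed.

Lemma sum_net_flow y (F : box beta -> R) :
  \sum_w net_flow y w * F w = \sum_c y c * (F (tgt c) - F (src c)).
Proof.
under eq_bigr do rewrite mulr_suml.
rewrite exchange_big; apply: eq_bigr => c _ /=.
under eq_bigr do rewrite -mulrA mulrC mulrBl.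
rewrite -mulr_suml mulrC; congr (_ * _).
rewrite sumrB; congr (_ - _).
  by under eq_bigr do rewrite mulrC; apply: sum_indicator.
by under eq_bigr do rewrite mulrC; apply: sum_indicator.
Qed.

Definition moment_coeff (z : 'cV[nat]_m) : {ffun pidx A beta -> nat} :=
  [ffun c => mono (boxv (tgt c)) z - mono (boxv (src c)) z]%N.

Lemma moment_coeffE z c : (moment_coeff z c)%:R =
  (mono (boxv (tgt c)) z)%:R - (mono (boxv (src c)) z)%:R :> R.
Proof. by rewrite ffunE natrB // mono_le // boxv_tgt; apply: vle_addr. Qed.

Lemma solvesE b y : vle b beta ->
  solves b moment_coeff (exponents beta) y <->
  forall w, net_flow y w = (w == node beta b)%:R - (w == node beta 0)%:R.
Proof.
move=> hb; have h0 : vle 0 beta by move=> j; rewrite mxE.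
have momentE z : \sum_w (net_flow y w -
      ((w == node beta b)%:R - (w == node beta 0)%:R)) * (mono (boxv w) z)%:R =
    \sum_c y c * (moment_coeff z c)%:R - ((mono b z)%:R - (mono 0 z)%:R).
  under eq_bigr do rewrite mulrBl mulrBl.
  rewrite !sumrB sum_net_flow; congr (_ - (_ - _)).
  - by apply: eq_bigr => c _; rewrite moment_coeffE.
  - by under eq_bigr do rewrite mulrC; rewrite sum_indicator nodeK.
  - by under eq_bigr do rewrite mulrC; rewrite sum_indicator nodeK.
split=> [h w|h z [zb /eqP z0]]; last first.
  have := momentE z; rewrite big1 => [/eqP|w _]; last by rewrite h subrr mul0r.
  rewrite mono0l // subr0 eq_sym subr_eq0 => /eqP e.
  by rewrite /equation e.
apply/eqP; rewrite -subr_eq0; apply/eqP; move: w; apply: mono_sum_eq0 => z zb.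
rewrite momentE; have [->|/eqP z0] := eqVneq z 0.
  rewrite !mono0r subrr subr0 big1 // => c _.
  by rewrite moment_coeffE !mono0r subrr mulr0.
by rewrite mono0l ?subr0 ?(h z) ?subrr //; apply/eqP.
Qed.

Lemma EmulE y : Emul y = \sum_c y c *: delta_mx (tag c) 0.
Proof.
apply/matrixP => k i; rewrite ord1 mxE summxE {i}.
rewrite [RHS](eq_bigr (fun c => if tag c == k then y c else 0)); last first.
  by move=> c _; rewrite !mxE eqxx andbT eq_sym; case: eqP;
    rewrite ?mulr1 ?mulr0.
rewrite -big_mkcond /=.
rewrite (eq_bigl (fun c => (tag c == k) && true)) => [|c];
  last by rewrite andbT.
have := @sig_big_dep R 0 +%R _ _ (pred1 k) (fun _ _ => true)
  (fun i (u : box (slack A beta i)) => y (pair_idx u)).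
by rewrite big_pred1_eq => ->; apply: eq_bigr => -[].
Qed.

End Network.

Section ConvexHull.
Context {R : realType} {V : lmodType R}.
Implicit Types (S C : set V) (x y : V) (a t : R).

Lemma convex_setP C : convex_set (C : set (convex_lmodType V)) <->
  forall x y t, 0 <= t <= 1 -> C x -> C y -> C (t *: x + (1 - t) *: y).
Proof.
split=> [h x y t /andP[t0 t1] Cx Cy|h x y t].
  by have := h x y (Itv01 t0 t1); rewrite !inE; apply.
by rewrite !inE; apply: h; apply/andP; split.
Qed.

Lemma convex_hull_conv S x y t : 0 <= t <= 1 ->
  convex_hull S x -> convex_hull S y -> convex_hull S (t *: x + (1 - t) *: y).
Proof.
move=> t01 hx hy C [cC SC].
by move/convex_setP: (cC); apply => //; [exact: hx|exact: hy].
Qed.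

Lemma convex_hull_min S C :
  (forall x y t, 0 <= t <= 1 -> C x -> C y -> C (t *: x + (1 - t) *: y)) ->
  S `<=` C -> convex_hull S `<=` C.
Proof. by move=> cC SC; apply: smallest_sub => //; apply/convex_setP. Qed.

Lemma sub_convex_hull S : S `<=` convex_hull S.
Proof. exact: sub_gen_smallest. Qed.

Lemma convex_hull_shift S S' x :
  (forall y, S y -> convex_hull S' (y + x)) ->
  forall y, convex_hull S y -> convex_hull S' (y + x).
Proof.
move=> h; apply: convex_hull_min => [y z t t01 hy hz|y Sy]; last exact: h.
suff -> : t *: y + (1 - t) *: z + x = t *: (y + x) + (1 - t) *: (z + x).
  exact: convex_hull_conv.
by rewrite !scalerDr addrACA -scalerDl addrC subrKC scale1r addrC.
Qed.

Lemma vertices_convex_hull S : vertices (convex_hull S) `<=` S.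
Proof.
move=> x [hx ext]; apply: contrapT => nSx.
suff : [set y | convex_hull S y /\ y <> x] x by case.
apply: convex_hull_min (hx) => [y z t t01 [hy yx] [hz zx]|y Sy]; last first.
  by split; [exact: sub_convex_hull|move=> e; apply: nSx; rewrite -e].
split; first exact: convex_hull_conv.
have [->|t0] := eqVneq t 0; first by rewrite scale0r add0r subr0 scale1r.
have [->|t1] := eqVneq t 1; first by rewrite subrr scale0r addr0 scale1r.
move=> /esym e; have yz : y = z.
  apply: (ext y z t) => //; case/andP: t01 => h0 h1.
  by rewrite !lt_neqAle eq_sym t0 t1 h0 h1.
by apply: yx; rewrite e yz -scalerDl addrC subrK scale1r.
Qed.

(* [a S], with the convention [0 S = {0}] even if [S] is empty. *)
Definition scaled S a : set V :=
  [set x | exists2 y, x = a *: y & a != 0 -> S y].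

Lemma scaledD S a b x y : 0 <= a -> 0 <= b ->
  scaled (convex_hull S) a x -> scaled (convex_hull S) b y ->
  scaled (convex_hull S) (a + b) (x + y).
Proof.
move=> a0 b0 [x' -> hx] [y' -> hy].
have [->|aN0] := eqVneq a 0; first by exists y'; rewrite ?scale0r !add0r.
have [->|bN0] := eqVneq b 0; first by exists x'; rewrite ?scale0r !addr0.
have abN0 : a + b != 0 by rewrite paddr_eq0 // negb_and aN0.
have e : 1 - a / (a + b) = b / (a + b).
  by rewrite -(divff abN0) -mulrBl addrAC subrr add0r.
exists (a / (a + b) *: x' + (1 - a / (a + b)) *: y').
  by rewrite scalerDr !scalerA e !(mulrC (a + b)) !divfK.
move=> _; apply: convex_hull_conv; [|exact: hx|exact: hy].
rewrite divr_ge0 ?addr_ge0 //= ler_pdivrMr ?mul1r ?lerDl //.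
by rewrite lt_neqAle eq_sym abN0 addr_ge0.
Qed.

Lemma scaledZ S a x t : scaled S a x -> scaled S (t * a) (t *: x).
Proof.
move=> [y -> h]; exists y; rewrite ?scalerA // mulf_eq0 negb_or.
by case/andP=> _; apply: h.
Qed.

Lemma scaled_shift S S' a x z : (forall y, S y -> S' (y + z)) ->
  scaled S a x -> scaled S' a (x + a *: z).
Proof.
move=> h [y -> hy]; exists (y + z); first by rewrite scalerDr.
by move=> /hy; apply: h.
Qed.

End ConvexHull.

Section IntegerHull.
Context {R : realType} {m n : nat} (A : 'M[nat]_(m, n)).
Implicit Types (b : 'cV[nat]_m) (x : 'cV[R]_n) (k : 'I_n).

Definition natv {p} (x : 'cV[nat]_p) : 'cV[R]_p :=
  map_mx (fun a : nat => a%:R) x.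

Definition int_points b : set 'cV[R]_n :=
  polyhedron R A b `&` [set x | forall k, x k 0 \is a Num.int].

Lemma int_pointsP b x :
  int_points b x <-> exists2 x' : 'cV[nat]_n, A *m x' = b & x = natv x'.
Proof.
have mulE (x' : 'cV[nat]_n) :
    map_mx (fun a : nat => a%:R) A *m natv x' = natv (A *m x').
  apply/matrixP => i j; rewrite !mxE natr_sum; apply: eq_bigr => k _.
  by rewrite !mxE natrM.
split=> [[[eq x0] xint]|[x' <- ->]]; last first.
  split; last by move=> k; rewrite mxE intr_nat.
  by split; [exact: mulE|move=> k; rewrite mxE ler0n].
pose x' : 'cV[nat]_n := \col_k Num.truncn (x k 0).
have xE : x = natv x'.
  apply/matrixP => k j; rewrite ord1 !mxE; apply/esym/eqP.
  by rewrite -natrEtruncn natrEint xint x0.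
exists x' => //; apply/matrixP => i j; move/matrixP: eq => /(_ i j).
by rewrite xE mulE !mxE => /eqP; rewrite eqr_nat => /eqP.
Qed.

Lemma natvD {p} (x y : 'cV[nat]_p) : natv (x + y) = natv x + natv y.
Proof. by apply/matrixP => i j; rewrite mxE addv_nat natrD !mxE. Qed.

Lemma natv_delta (p : nat) (k : 'I_p) : natv (delta_mx k 0) = delta_mx k 0.
Proof. by apply/matrixP => i j; rewrite !mxE; case: (_ && _). Qed.

Lemma natv0 p : natv (0 : 'cV[nat]_p) = 0.
Proof. by apply/matrixP => i j; rewrite !mxE. Qed.

Lemma int_points_shift b x k :
  int_points b x -> int_points (b + col k A) (x + delta_mx k 0).
Proof.
move=> /int_pointsP[x' <- ->]; apply/int_pointsP.
exists (x' + delta_mx k 0); last by rewrite natvD natv_delta.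
by rewrite mulmxDr colE.
Qed.

Lemma sub_delta p (x : 'cV[nat]_p) (k : 'I_p) :
  x k 0 != 0 -> exists x' : 'cV[nat]_p, x = x' + delta_mx k 0.
Proof.
move=> xk; exists (\col_j (x j 0%R - (j == k))%N).
apply/matrixP => j i; rewrite ord1 addv_nat !mxE eqxx andbT {i}.
by case: eqVneq => [->|_] /=; rewrite ?subn0 ?addn0 // subnK // lt0n.
Qed.

Let H b := integer_hull (polyhedron R A b).

Lemma integer_hull_natv (x : 'cV[nat]_n) : H (A *m x) (natv x).
Proof.
have : int_points (A *m x) (natv x) by apply/int_pointsP; exists x.
exact: sub_convex_hull.
Qed.

Lemma integer_hull_shift b x k : H b x -> H (b + col k A) (x + delta_mx k 0).
Proof.
apply: convex_hull_shift => {}x hx.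
by apply: sub_convex_hull; apply: int_points_shift.
Qed.

Lemma integer_hull_recession b x k t :
  0 <= t -> col k A = 0 -> H b x -> H b (x + t *: delta_mx k 0).
Proof.
move=> t0 k0; apply: convex_hull_shift => {}x hx.
have hN N : H b (x + N%:R *: delta_mx k 0).
  apply: sub_convex_hull; elim: N => [|N IH]; first by rewrite scale0r addr0.
  rewrite -natr1 scalerDl scale1r addrA -[b]addr0 -k0.
  exact: int_points_shift.
pose N := Num.bound t.
have tN : t < N%:R by apply: archi_boundP.
have N0 : 0 < N%:R :> R by apply: le_lt_trans tN.
have : H b ((t / N%:R) *: (x + N%:R *: delta_mx k 0)
           + (1 - t / N%:R) *: (x + 0%:R *: delta_mx k 0)).
  apply: convex_hull_conv => //; [|exact: hN|exact: hN].
  by rewrite divr_ge0 ?ler0n //= ler_pdivrMr // mul1r ltW.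
rewrite scale0r addr0 scalerDr scalerA divfK ?gt_eqF // addrAC -scalerDl.
by rewrite addrC subrKC scale1r addrC.
Qed.

Lemma integer_hull_solution b x : H b x -> exists x' : 'cV[nat]_n, A *m x' = b.
Proof.
move=> hx; apply: contrapT => no.
have : (set0 : set 'cV[R]_n) x; last by [].
apply: convex_hull_min hx => // {}x /int_pointsP[x' e _].
by apply: no; exists x'.
Qed.

Lemma vertices_integer_hull b x : vertices (H b) x ->
  exists x' : 'cV[nat]_n, [/\ x = natv x', A *m x' = b &
    forall k, x' k 0 != 0 -> col k A != 0].
Proof.
move=> vx; have /int_pointsP[x' eb ex] : int_points b x.
  exact: vertices_convex_hull vx.
exists x'; split=> // k xk; apply/eqP => k0.
have [x2 ex2] := sub_delta xk.
have hx2 : H b (natv x2).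
  by rewrite -eb ex2 mulmxDr -colE k0 addr0; apply: integer_hull_natv.
have hz := integer_hull_recession (ler0n R 2) k0 hx2.
have half : 0 < (2^-1 : R) < 1 by rewrite invr_gt0 ltr0n invf_lt1 ?ltr0n ?ltr1n.
have [_ ext] := vx.
have : natv x2 = natv x2 + 2 *: delta_mx k 0.
  apply: ext hx2 hz half _.
  rewrite scalerDr addrA -scalerDl addrC subrKC scale1r scalerA.
  rewrite mulrBl mul1r mulVf ?pnatr_eq0 // -(natr1 1) addrK scale1r.
  by rewrite ex ex2 natvD natv_delta addrC.
move=> /eqP; rewrite -subr_eq0 opprD addNKr oppr_eq0.
move=> /eqP/matrixP/(_ k 0)/eqP.
by rewrite !mxE !eqxx mulr1 pnatr_eq0.
Qed.

End IntegerHull.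

Section Decomposition.
Context {R : realType} {m n : nat} {A : 'M[nat]_(m, n)} {beta : 'cV[nat]_m}.
Hypothesis hA : forall k : 'I_n, vle (col k A) beta.
Implicit Types (c : pidx A beta) (w : box beta) (b : 'cV[nat]_m)
  (y : {ffun pidx A beta -> R^o}) (g : box beta -> R).

Let H b := integer_hull (polyhedron R A b).

Lemma net_flow_single c0 (a : R) w :
  net_flow
    ([ffun c => if c == c0 then a else 0] : {ffun pidx A beta -> R^o}) w =
  a * ((w == tgt c0)%:R - (w == src c0)%:R).
Proof.
rewrite /net_flow (bigD1 c0) //= ffunE eqxx big1 ?addr0 // => c /negbTE h.
by rewrite ffunE h mul0r.
Qed.

Lemma Emul_single c0 (a : R) :
  Emul ([ffun c => if c == c0 then a else 0] : {ffun pidx A beta -> R^o}) =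
  a *: delta_mx (tag c0) 0.
Proof.
rewrite EmulE (bigD1 c0) //= ffunE eqxx big1 ?addr0 // => c /negbTE h.
by rewrite ffunE h scale0r.
Qed.

Lemma net_flowD y1 y2 w : net_flow (y1 + y2) w = net_flow y1 w + net_flow y2 w.
Proof.
by rewrite -big_split; apply: eq_bigr => c _; rewrite /= ffunE mulrDl.
Qed.

Lemma EmulD y1 y2 : Emul (y1 + y2) = Emul y1 + Emul y2.
Proof.
by rewrite !EmulE -big_split; apply: eq_bigr => c _; rewrite /= ffunE scalerDl.
Qed.

Let active y := [set c | (y c != 0) && (src c != tgt c)]%SET.

Lemma net_flow_decomposition y g (v : R) : nonneg y -> (forall w, 0 <= g w) ->
  (forall w, net_flow y w = g w - v * (w == node beta 0)%:R) ->
  exists2 X : box beta -> 'cV[R]_n,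
    forall w, scaled (H (boxv w)) (g w) (X w) &
    Emul y = \sum_w X w +
      \sum_(c | src c == tgt c) y c *: delta_mx (tag c) 0.
Proof.
(* Induction on the number of non-loop arcs carrying flow: remove one whose
   source has maximal degree; only loops leave its target. *)
have [N leN] := ubnP #|active y|.
elim: N y g leN => // N IH y g leN y0 g0 bal.
have [c1 c1act|noact] := pickP (mem (active y)); last first.
  have yE c : src c != tgt c -> y c = 0.
    by move=> h; apply/eqP; move: (noact c); rewrite !inE h andbT => /negbFE.
  exists (fun=> 0) => [w|].
    exists 0; rewrite ?scaler0 // => gw.
    have : net_flow y w = 0.
      apply: big1 => c _; have [->|/yE ->] := eqVneq (src c) (tgt c).
        by rewrite subrr mulr0.
      by rewrite mul0r.
    rewrite bal => /eqP; rewrite subr_eq0 => /eqP gE.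
    have [w0|wN] := eqVneq w (node beta 0); last first.
      by move: gw; rewrite gE (negbTE wN) mulr0 eqxx.
    have := @integer_hull_natv R m n A 0; rewrite mulmx0 natv0 w0 nodeK // => j.
    by rewrite mxE.
  rewrite EmulE sumr_const mul0rn add0r [RHS]big_mkcond; apply: eq_bigr => c _.
  by case: eqVneq => // /yE ->; rewrite scale0r.
case: (@arg_maxnP _ c1 (mem (active y)) (fun c => deg (boxv (src c))) c1act).
move=> c0; rewrite !inE => /andP[yc0 ne] cmax {c1 c1act}.
set a := y c0; set t := src c0; set h := tgt c0.
have a0 : 0 < a by rewrite lt_neqAle eq_sym yc0 y0.
pose d : {ffun pidx A beta -> R^o} := [ffun c => if c == c0 then a else 0].
pose y' := y - d.
have yD : y = y' + d by rewrite subrK.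
have y'E c : y' c = if c == c0 then 0 else y c.
  by rewrite !ffunE; case: eqP => [->|_]; rewrite ?subrr ?subr0.
pose g' w := g w - a * ((w == h)%:R - (w == t)%:R).
have hN0 : h != node beta 0.
  apply/eqP => e; have := deg_tgt hA ne.
  rewrite -/h e nodeK; last by move=> j; rewrite mxE.
  by have /eqP -> : deg (0 : 'cV[nat]_m) == 0%N by rewrite deg_eq0.
have ght : a <= g h.
  have : net_flow y h = g h by rewrite bal (negbTE hN0) mulr0 subr0.
  move=> <-; rewrite /net_flow (bigD1 c0) //= -/h -/t -/a eqxx.
  rewrite (_ : (h == t) = false) ?subr0 ?mulr1;
    last by rewrite eq_sym; apply/negbTE.
  rewrite lerDl sumr_ge0 // => c _.
  have [<-|hc] := eqVneq (src c) (tgt c); first by rewrite subrr mulr0.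
  have [->|yc] := eqVneq (y c) 0; first by rewrite mul0r.
  rewrite mulr_ge0 // [h == src c](_ : _ = false) ?subr0 ?ler0n //.
  apply/negbTE/eqP => e; have := cmax c; rewrite !inE yc hc => /(_ isT).
  by rewrite -e /= leqNgt (deg_tgt hA ne).
have g'0 w : 0 <= g' w.
  rewrite /g'; have [->|wh] := eqVneq w h.
    by rewrite eq_sym (negbTE ne) subr0 mulr1 subr_ge0.
  by rewrite sub0r mulrN opprK addr_ge0 // mulr_ge0 ?ler0n // ltW.
have bal' w : net_flow y' w = g' w - v * (w == node beta 0)%:R.
  have := bal w; rewrite {1}yD net_flowD net_flow_single.
  move=> /(canRL (addrK _)) ->.
  by rewrite /g' addrAC.
have leN' : (#|active y'| < N)%N.
  rewrite -ltnS; apply: leq_trans leN; rewrite ltnS; apply: proper_card.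
  apply/properP; split.
    by apply/fintype.subsetP => c; rewrite !inE y'E; case: ifP; rewrite ?eqxx.
  by exists c0; rewrite !inE ?y'E ?eqxx // yc0.
have y'0 : nonneg y' by move=> c; rewrite y'E; case: ifP.
have [X' X'sc X'sum] := IH y' g' leN' y'0 g'0 bal'.
(* The fraction [p] of the mass at [t] that [c0] carries moves to [h]. *)
have ga : 0 < g t + a by rewrite ltr_wpDl.
pose p := a / (g t + a).
have g't : g' t = g t + a.
  by rewrite /g' eqxx (negbTE ne) sub0r mulrN1 opprK.
have pg't : p * g' t = a by rewrite g't divfK // gt_eqF.
pose e : 'cV[R]_n := delta_mx (tag c0) 0.
exists (fun w => X' w - (w == t)%:R *: (p *: X' t)
                 + (w == h)%:R *: (p *: X' t + a *: e)) => [w|].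
  have [->|wh] := eqVneq w h.
    rewrite eq_sym (negbTE ne) scale0r subr0 scale1r.
    have -> : g h = g' h + a.
      by rewrite /g' eqxx eq_sym (negbTE ne) subr0 mulr1 subrK.
    apply: scaledD (X'sc h) _ => //; first exact: ltW.
    have := scaledZ p (X'sc t); rewrite pg't => hs.
    apply: scaled_shift hs => x hx.
    by rewrite boxv_tgt //; apply: integer_hull_shift.
  rewrite scale0r addr0; have [->|wt] := eqVneq w t; last first.
    rewrite scale0r subr0; have := X'sc w.
    by rewrite /g' (negbTE wh) (negbTE wt) subrr mulr0 subr0.
  rewrite scale1r -{1}[X' t]scale1r -scalerBl.
  have -> : g t = (1 - p) * g' t by rewrite mulrBl mul1r pg't g't addrK.
  exact: scaledZ.
have sum1 z (x : 'cV[R]_n) : \sum_w (w == z)%:R *: x = x.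
  rewrite (bigD1 z) //= eqxx scale1r big1 ?addr0 // => w /negbTE ->.
  by rewrite scale0r.
rewrite {1}yD EmulD Emul_single X'sum !big_split /= sumrN !sum1 subrKA addrAC.
congr (_ + _); apply: eq_bigr => c /eqP hc; rewrite y'E; case: eqP => // cc.
by move: ne; rewrite -cc hc eqxx.
Qed.

Lemma flow_integer_hull b y : vle b beta -> nonneg y ->
  (forall w, net_flow y w = (w == node beta b)%:R - (w == node beta 0)%:R) ->
  H b (Emul y).
Proof.
move=> hb y0 bal.
have [|w|X Xsc ->] := @net_flow_decomposition y
  (fun w => (w == node beta b)%:R) 1 y0.
- by move=> w; apply: ler0n.
- by rewrite bal mul1r.
have Xb : H b (X (node beta b)).
  have := Xsc (node beta b); rewrite eqxx nodeK // => -[x -> hx].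
  by rewrite scale1r; apply: hx; apply: oner_neq0.
rewrite (bigD1 (node beta b)) //= big1 => [|w wb]; last first.
  by have := Xsc w; rewrite (negbTE wb) => -[x -> _]; rewrite scale0r.
rewrite addr0.
apply: (big_ind (fun z => forall x, H b x -> H b (x + z))) Xb.
- by move=> x; rewrite addr0.
- by move=> z1 z2 h1 h2 x hx; rewrite addrA; apply: h2; apply: h1.
- move=> c hc x; apply: integer_hull_recession => //.
  by apply/eqP; rewrite -src_eq_tgt.
Qed.

End Decomposition.

Section Paths.
Context {R : realType} {m n : nat} {A : 'M[nat]_(m, n)} {beta : 'cV[nat]_m}.
Hypothesis hA : forall k : 'I_n, vle (col k A) beta.
Implicit Types (c : pidx A beta) (w : box beta) (b : 'cV[nat]_m)
  (y : {ffun pidx A beta -> R^o}).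

Definition simple y :=
  (forall c, y c != 0 -> src c != tgt c) /\
  (forall c1 c2, y c1 != 0 -> y c2 != 0 -> src c1 = src c2 -> c1 = c2).

Lemma path_flow (x : 'cV[nat]_n) : vle (A *m x) beta ->
  exists y, [/\ nonneg y,
    forall w, net_flow y w =
      (w == node beta (A *m x))%:R - (w == node beta 0)%:R,
    Emul y = natv x &
    (forall k, x k 0 != 0 -> col k A != 0) ->
      simple y /\ forall c, y c != 0 -> vle (boxv (tgt c)) (A *m x)].
Proof.
have [N] := ubnP (deg x); elim: N x => // N IH x leN xbeta.
have [/existsP[k xk]|x0] := boolP [exists k, x k 0 != 0]; last first.
  have {}x0 : x = 0.
    apply/matrixP => k i; rewrite ord1 mxE; apply/eqP.
    by apply: contraNT x0 => xk; apply/existsP; exists k.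
  exists 0; split.
  - by move=> c; rewrite ffunE.
  - move=> w; rewrite x0 mulmx0 subrr /net_flow big1 // => c _.
    by rewrite ffunE mul0r.
  - by rewrite EmulE x0 natv0 big1 // => c _; rewrite ffunE scale0r.
  - move=> _; split; [split=> [c|c1 c2]|move=> c]; by rewrite ffunE eqxx.
have [x' ex] := sub_delta xk.
have Ax : A *m x = A *m x' + col k A by rewrite ex mulmxDr -colE.
have x'x : vle (A *m x') (A *m x) by rewrite Ax; apply: vle_addr.
have leN' : (deg x' < N)%N.
  rewrite -ltnS; apply: leq_trans leN; rewrite ltnS ex degD -addn1 leq_add2l.
  rewrite lt0n deg_eq0; apply/eqP => /matrixP/(_ k 0).
  by rewrite !mxE !eqxx.
have [y [y0 bal Ey sy]] := IH x' leN' (vle_trans x'x xbeta).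
have Axk : vle (A *m x' + col k A) beta by rewrite -Ax.
pose c0 : pidx A beta := step k (A *m x').
pose d : {ffun pidx A beta -> R^o} := [ffun c => if c == c0 then 1 else 0].
have ydE c : c != c0 -> (y + d) c = y c.
  by move=> /negbTE h; rewrite !ffunE h addr0.
exists (y + d); split.
- by move=> c; rewrite !ffunE addr_ge0 //; case: ifP.
- move=> w; rewrite net_flowD bal net_flow_single mul1r src_step // tgt_step //.
  by rewrite -Ax addrC addrA subrK.
- by rewrite EmulD Ey Emul_single scale1r ex natvD natv_delta.
move=> xA; have [|[loopfree inj] le_tgt] := sy.
  move=> i; rewrite -lt0n => xi; apply: xA.
  by rewrite ex addv_nat -lt0n addn_gt0 xi.
have srcN c : y c != 0 -> src c != src c0.
  move=> yc; apply/eqP => e; have := deg_tgt hA (loopfree c yc).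
  rewrite ltnNge e src_step // nodeK ?deg_le //; first exact: le_tgt.
  exact: vle_trans xbeta.
have supp c : (y + d) c != 0 -> c = c0 \/ y c != 0.
  by have [->|/ydE ->] := eqVneq c c0; [left|right].
split; first split.
- move=> c /supp[->|]; last exact: loopfree.
  by rewrite src_eq_tgt //; apply: xA.
- move=> c1 c2 /supp[->|yc1] /supp[->|yc2] // e.
  + by have := srcN _ yc2; rewrite e eqxx.
  + by have := srcN _ yc1; rewrite e eqxx.
  + exact: inj.
- move=> c /supp[->|yc]; last exact: vle_trans (le_tgt c yc) x'x.
  by rewrite tgt_step // nodeK -Ax.
Qed.

Lemma simple_vertex b y : vle b beta -> nonneg y ->
  (forall w, net_flow y w = (w == node beta b)%:R - (w == node beta 0)%:R) ->
  simple y -> vertices (flow_polyhedron R A beta b) y.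
Proof.
move=> hb y0 bal [loopfree inj]; split; first exact/flow_polyhedronE.
move=> y1 y2 t /(flow_polyhedronE hA _ hb)[y10 bal1].
move=> /(flow_polyhedronE hA _ hb)[y20 bal2] /andP[t0 t1] yE.
have t1' : 0 < 1 - t by rewrite subr_gt0.
have supp c : y c = 0 -> y1 c = y2 c.
  move/eqP; rewrite yE !ffunE paddr_eq0 ?mulr_ge0 // ?ltW //.
  by rewrite !mulf_eq0 (gt_eqF t0) (gt_eqF t1') /= => /andP[/eqP -> /eqP ->].
suff d0 N c : (deg (boxv (src c)) < N)%N -> y1 c = y2 c.
  by apply/ffunP => c; apply: d0 (ltnSn _).
elim: N c => // N IH c cN.
have [/supp //|yc] := eqVneq (y c) 0.
have : net_flow y1 (src c) - net_flow y2 (src c) = 0 by rewrite bal1 bal2 subrr.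
rewrite -sumrB (bigD1 c) //= [X in _ + X]big1 => [|c' c'c]; last first.
  rewrite -mulrBl; have [/supp ->|yc'] := eqVneq (y c') 0.
    by rewrite subrr mul0r.
  have [e|ne] := eqVneq (src c) (tgt c').
    rewrite IH ?subrr ?mul0r //; rewrite ltnS in cN; apply: leq_trans cN.
    by rewrite e; apply/(deg_tgt hA)/loopfree.
  case: eqVneq => [/esym/(inj _ _ yc' yc) ec|_]; last by rewrite subrr mulr0.
  by move: c'c; rewrite ec eqxx.
rewrite addr0 -mulrBl eqxx (negbTE (loopfree _ yc)) sub0r mulrN1 => /eqP.
by rewrite oppr_eq0 subr_eq0 => /eqP.
Qed.

End Paths.

Theorem corollary9 (R : realType) (m n : nat) (A : 'M[nat]_(m, n))
    (beta : 'cV[nat]_m) (hA : forall k : 'I_n, vle (col k A) beta) :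
  exists Az : 'cV[nat]_m -> {ffun pidx A beta -> nat},
    (forall j : 'I_m, vle (delta_mx j 0) beta ->
       forall (k : 'I_n) (u : box (slack A beta k)),
         Az (delta_mx j 0) (pair_idx u) = A j k) /\
    forall b : 'cV[nat]_m, vle b beta ->
      let S := exponents beta in
      let H := integer_hull (polyhedron R A b) in
      let P := flow_polyhedron R A beta b in
      ((exists x : 'cV[nat]_n, A *m x = b) <->
       (exists y : {ffun pidx A beta -> R^o}, nonneg y /\ solves b Az S y)) /\
      [/\ forall y : {ffun pidx A beta -> R^o},
            nonneg y -> solves b Az S y -> H (Emul y),
          forall Z : set 'cV[nat]_m, Z `<=` S ->
            ~ (exists y : {ffun pidx A beta -> R^o}, solves b Az Z y) ->
            forall x : 'cV[nat]_n, b <> A *m x,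
          forall y : {ffun pidx A beta -> R^o},
            nonneg y -> (solves b Az S y <-> P y) &
          exists phi : 'cV[R]_n -> {ffun pidx A beta -> R^o},
            [/\ set_fun (vertices H) (vertices P) phi,
                set_inj (vertices H) phi &
                forall x, vertices H x -> Emul (phi x) = x]].
Proof.
exists moment_coeff; split=> [j _ k u|b hb S H P].
  rewrite ffunE !mono_delta boxv_tgt // addv_nat [col _ _ _ _]mxE.
  by rewrite addKn.
have solvable (x : 'cV[nat]_n) : A *m x = b ->
    exists y : {ffun pidx A beta -> R^o}, nonneg y /\ solves b moment_coeff S y.
  move=> ex; have [|y [y0 bal _ _]] := path_flow hA (x := x) (R := R).
    by rewrite ex.
  by exists y; split=> //; apply/(solvesE hA _ hb) => w; rewrite bal ex.
have hull (y : {ffun pidx A beta -> R^o}) :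
    nonneg y -> solves b moment_coeff S y -> H (Emul y).
  by move=> y0 /(solvesE hA _ hb); apply: flow_integer_hull.
split; [split|split].
- by move=> [x /solvable].
- by move=> [y [y0 hy]]; apply: integer_hull_solution (hull y y0 hy).
- exact: hull.
- move=> Z ZS unsolvable x ex; apply: unsolvable.
  have [y [_ hy]] := solvable x (esym ex).
  by exists y => z /ZS; apply: hy.
- move=> y y0; rewrite /P; split=> [/(solvesE hA _ hb) bal|].
    exact/(flow_polyhedronE hA _ hb).
  by move=> /(flow_polyhedronE hA _ hb)[_ bal]; apply/(solvesE hA _ hb).
have vertex_flow x : exists y : {ffun pidx A beta -> R^o},
    vertices H x -> vertices P y /\ Emul y = x.
  have [vx|nvx] := pselect (vertices H x); last by exists 0.
  have [x' [-> ex xA]] := vertices_integer_hull vx.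
  have [|y [y0 bal Ey /(_ xA)[sy _]]] := path_flow hA (x := x') (R := R).
    by rewrite ex.
  exists y => _; split=> //; apply: simple_vertex sy => // w.
  by rewrite bal ex.
have [phi phiP] := choice vertex_flow.
exists phi; split=> [x /phiP[]|x1 x2|x /phiP[]] //.
by rewrite !inE => /phiP[_ e1] /phiP[_ e2] e; rewrite -e1 e e2.
Qed.
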